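(* Let $I\colon[0,1]^2\to[0,1]$ be a fuzzy implication satisfying the ordering property: for all $x,y\in[0,1]$, $x\le y \iff I(x,y)=1$. Then the following statements are equivalent: (i) $I(I(y,x),I(x,y))=I(x,y)$ for all $x,y\in[0,1]$; (ii) $I$ has the left neutrality property on its range, i.e. $I(1,\alpha)=\alpha$ for every $\alpha$ in the range $\{I(x,y) : x,y\in[0,1]\}$ of $I$.
   Context: A function $I\colon[0,1]^2\to[0,1]$ is a fuzzy implication if $I(\cdot,y)$ is decreasing (non-increasing) for each $y$, $I(x,\cdot)$ is increasing (non-decreasing) for each $x$, and $I(0,0)=1$, $I(1,1)=1$, $I(1,0)=0$. The left neutrality property (NP) is $I(1,y)=y$; ''on its range'' means it is required only for $y$ in the range of $I$. *)

(* Defs.v *)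
From mathcomp Require Import all_boot all_order all_algebra.
From mathcomp Require Import interval_inference reals.
Set Implicit Arguments.
Unset Strict Implicit.
Unset Printing Implicit Defensive.
Import Order.TTheory GRing.Theory Num.Theory.
Local Open Scope ring_scope.

Section FuzzyImplication.
Variables (R : realType).
Implicit Types (I : {i01 R} -> {i01 R} -> {i01 R}).

Definition fuzzy_implication I : Prop :=
  [/\ forall y, {homo I^~ y : x1 x2 /~ x1 <= x2},
      forall x, {homo I x : y1 y2 / y1 <= y2},
      I 0%:i01 0%:i01 = 1%:i01,
      I 1%:i01 1%:i01 = 1%:i01
    & I 1%:i01 0%:i01 = 0%:i01].

Definition ordering_property I : Prop :=
  forall x y, x <= y <-> I x y = 1%:i01.

Definition NP_on_range I : Prop :=
  forall a, (exists x y, a = I x y) -> I 1%:i01 a = a.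

End FuzzyImplication.

(* Main.v *)
Require Import Defs.
From mathcomp Require Import all_boot all_order all_algebra.
From mathcomp Require Import interval_inference reals.
Import Order.TTheory GRing.Theory Num.Theory.
Local Open Scope ring_scope.

(** The order on the unit interval is total, so the ordering property makes [I x y] or [I y x] equal
    to [1]. If [I x y = 1], both equations reduce to [I z 1 = 1], true since [z <= 1]. If
    [I y x = 1], the absorption law at [x], [y] is exactly left neutrality at the value [I x y]. *)

Theorem theorem2p1 (R : realType) (I : {i01 R} -> {i01 R} -> {i01 R})
    (I_impl : fuzzy_implication I) (I_OP : ordering_property I) :
  (forall x y : {i01 R}, I (I y x) (I x y) = I x y) <-> NP_on_range I.
Proof.
have le1 (z : {i01 R}) : z <= 1%:i01 by rewrite -num_le /=.
have I_eq1 x y : x <= y -> I x y = 1%:i01 by move/I_OP.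
split=> [absorb a [x [y ->]] | NP x y].
  have [/I_eq1->|/I_eq1 Iyx] := orP (le_total x y); first exact: I_eq1.
  (* Reading the [1] in the first argument as [I y x] turns the goal into [absorb x y]. *)
  by rewrite -Iyx.
have [/I_eq1->|/I_eq1->] := orP (le_total x y); first exact/I_eq1/le1.
by apply: NP; exists x, y.
Qed.
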